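(* There exist a finitely generated group $G$ and a symmetric, finitely supported probability measure $\mu$ on $G$ whose support generates $G$, such that $G$ is non-Liouville with respect to $\mu$ (that is, there exists a nonconstant bounded $\mu$-harmonic function on $G$) and the upper return probability exponent of the random walk on $G$ with step distribution $\mu$ satisfies $\overline{\gamma} \leq 1/2$.
   Context: A function $f : G \to \mathbb{R}$ is $\mu$-harmonic if $f(g) = \sum_{h \in G} f(gh)\mu(h)$ for all $g \in G$. $G$ has the Liouville property with respect to $\mu$ if every bounded $\mu$-harmonic function on $G$ is constant; otherwise it is non-Liouville with respect to $\mu$. Symmetric means $\mu(g)=\mu(g^{-1})$ for all $g$. The random walk with step distribution $\mu$ is $X_n = g_1 g_2 \cdots g_n$ with $g_i$ independent and distributed according to $\mu$; $p_{n}(e,e) = \mathbb{P}(X_n = e)$, where $e$ is the identity of $G$. The upper return probability exponent is $$\overline{\gamma} = \limsup_{n \to \infty} \frac{\log |\log p_{2n}(e,e)|}{\log n}.$$ *)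

(* Defs.v *)
From HB Require Import structures.
From mathcomp Require Import all_boot all_order all_algebra.
From mathcomp Require Import all_classical all_reals all_analysis.

Set Implicit Arguments.
Unset Strict Implicit.
Unset Printing Implicit Defensive.

Import Order.TTheory GRing.Theory Num.Theory.
Import numFieldNormedType.Exports.

Local Open Scope classical_set_scope.
Local Open Scope ring_scope.

Definition subgroup_generated (G : groupType) (S : set G) : set G :=
  smallest [set H : set G | group_closed (mem H)] S.

Definition finitely_generated (G : groupType) : Prop :=
  exists2 S : set G, finite_set S & subgroup_generated S = [set: G].

Definition msupport (R : realType) (G : groupType) (mu : G -> R) : set G :=
  [set g | mu g != 0].

(* The sums \sum_(g \in A) below are fsbigop sums, which are 0 by convention
   when the summand has infinite support; they are the intended sums here
   because every mu considered is finitely supported. *)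
Definition finsupp_probability (R : realType) (G : groupType) (mu : G -> R) :
    Prop :=
  [/\ finite_set (msupport mu),
      forall g, 0 <= mu g
    & \sum_(g \in [set: G]) mu g = 1].

Definition symmetric_measure (R : realType) (G : groupType) (mu : G -> R) :
    Prop :=
  forall g, mu g = mu (g^-1)%g.

Definition harmonic (R : realType) (G : groupType) (mu f : G -> R) : Prop :=
  forall g, f g = \sum_(h \in [set: G]) f (g * h)%g * mu h.

Definition liouville (R : realType) (G : groupType) (mu : G -> R) : Prop :=
  forall f : G -> R, harmonic mu f -> bounded_fun f -> exists c, f = cst c.

(* The probability of the event A for n independent steps with law mu, i.e.
   its mass under the n-fold product measure of mu. *)
Definition steps_prob (R : realType) (G : groupType) (mu : G -> R) (n : nat)
    (A : set (n.-tuple G)) : R :=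
  \sum_(w \in A) \prod_(i < n) mu (tnth w i).

Definition walk (G : groupType) (n : nat) (w : n.-tuple G) : G :=
  (\prod_(i < n) tnth w i)%g.

Definition return_prob (R : realType) (G : groupType) (mu : G -> R) (n : nat) :
    R :=
  steps_prob mu [set w : n.-tuple G | walk w = 1%g].

(* The conventions ln 0 = 0 and x / 0 = 0 are harmless: for a finitely supported
   symmetric probability mu, p_{2n}(e,e) > 0, and p_{2n}(e,e) = 1 with n > 0
   only if mu is a point mass. *)
Definition upper_return_exponent (R : realType) (G : groupType) (mu : G -> R) :
    \bar R :=
  limn_esup (fun n : nat =>
    (ln `|ln (return_prob mu (2 * n))| / ln n%:R)%:E).

(* Main.v *)
Require Import Defs.
From HB Require Import structures.
From mathcomp Require Import all_boot all_order all_algebra.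
From mathcomp Require Import all_classical all_reals all_analysis.
From mathcomp Require Import finmap zify ring lra.

(** The group is a permutational wreath product [Z/2 wr_S H] over the base
    group [H = Z/2 wr Z], acting on a transitive [H]-set [S] which is barely
    transient: its balls have volume [r ^ (2 + o(1))], but the simple random
    walk on it escapes.  Non-Liouvilleness comes from the transience of [S],
    and the return probability from the volume growth of [S].

    The set [S].  An element of [H] is a pair [(phi, n)] of a configuration
    [phi] of lamps on [Z] and a cursor [n].  Fix a sparse sequence of marks
    [d_1 < d_2 < ...] with [d_(j+1) - d_j] close to [2^j / (j+1)^2] and let [S]
    be [H / K], where [K] consists of the [(phi, 0)] with [phi] vanishing on all
    marks.  A coset remembers the cursor and one bit per mark.  The orbit of the
    base point under the elements of [H] that live on [[-r, r]] has size about
    [r * 2^J], where [J] is the number of marks below [2r], and the choice of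
    the marks gives [2^J = O(r log^2 r)].

    A bounded harmonic function.  On [S], seen from the origin, the walk is that
    of a lamplighter on [Z] whose lamps are at the marks only.  When each visit
    to a mark randomises its lamp, the function [M (max n t)], with [t] the
    position of the furthest lit mark, is harmonic away from the root as soon as
    [M] is affine between the marks and its slope is halved at each mark
    ([height_harmonic]): at a mark with no further lamp lit, the lamp is on with
    probability [1/2], in which case a step towards the origin does not decrease
    the value.  It vanishes at the root, and it is bounded because the sum of
    [2^-j (d_(j+1) - d_j)] converges.  Multiplying it by the sign [(-1)^b], where
    [b] is the state of the upper lamp at the root of [S], gives a bounded
    harmonic function on the whole group ([signed_height_harmonic]): that lamp
    can only be switched when the walk on [S] is at the root, where the function
    vanishes, so the sign change is invisible.

    The return probability.  By Cauchy-Schwarz and symmetry, [p_2n(e,e)] is at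
    least [P(X_n in B)^2 / #B] for every finite set [B].  Take for [B] the
    elements reached by words whose cursor stays in [[-r, r]].  The cursor is a
    simple random walk on [Z], so it is confined for time [n] with probability
    at least [exp (- c n / r^2)] ([num_confined0_ge]), while [ln #B] is at most
    a constant times [r * 2^J], that is [r^2] up to logarithmic factors
    ([card_loops], [card_code_le]).  With [r = n^(1/4)] both exponents are
    [n^(1/2 + o(1))]. *)

Set Implicit Arguments.
Unset Strict Implicit.
Unset Printing Implicit Defensive.

Import Order.TTheory GRing.Theory Num.Theory.

Local Open Scope classical_set_scope.
Local Open Scope ring_scope.

(** * Random walks driven by a finite family of steps *)

(** This turns the finitely supported sums over the group, or over tuples of
    group elements, into sums over words in a finite alphabet. *)
Lemma fsbig_pushforward (R : realType) (T : choiceType) (V : finType)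
    (e : V -> T) (c : V -> R) (A : set T) :
  \sum_(x \in A) \sum_v (e v == x)%:R * c v = \sum_(v | e v \in A) c v.
Proof.
rewrite fsbig_mkcond (fsbigTE [fset x | x in codom e]%fset); last first.
  move=> x; rewrite inE/= /patch => xe; case: ifP => // _.
  rewrite big1// => v _; case: eqP => [ev|_]; last by rewrite mul0r.
  by move: xe; rewrite -ev codom_f.
rewrite (eq_bigr (fun x => \sum_(v | e v \in A) (e v == x)%:R * c v)); last first.
  move=> x _; rewrite /patch; case: ifPn => xA.
    rewrite [RHS]big_mkcond/=; apply: eq_bigr => v _.
    by case: eqP => [->|_]; rewrite ?xA// mul0r if_same.
  rewrite big1// => v vA; case: eqP => [ev|_]; last by rewrite mul0r.
  by rewrite -ev vA in xA.
rewrite exchange_big/=; apply: eq_bigr => v _.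
rewrite (big_fsetD1 (e v))/=; last by rewrite inE codom_f.
rewrite eqxx mul1r big_seq big1 ?addr0// => x; rewrite !inE => /andP[xe _].
by rewrite eq_sym (negbTE xe) mul0r.
Qed.

Section UniformSteps.
Variables (R : realType) (G : groupType) (I : finType) (gen : I -> G).

(** The law of [gen i] for a uniformly chosen index [i]: indices with the same
    image add up their weights. *)
Definition uniform_steps (g : G) : R :=
  \sum_i (gen i == g)%:R * #|I|%:R^-1.

Lemma sum_uniform_steps (f : G -> R) :
  \sum_(h \in [set: G]) f h * uniform_steps h = \sum_i f (gen i) * #|I|%:R^-1.
Proof.
rewrite (eq_fsbigr (fun h : G =>
    \sum_i (gen i == h)%:R * (f (gen i) * #|I|%:R^-1))); last first.
  move=> h _; rewrite mulr_sumr; apply: eq_bigr => i _.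
  by case: eqP => [->|_]; rewrite ?mul1r// !mul0r mulr0.
by rewrite fsbig_pushforward; apply: eq_bigl => i; rewrite in_setT.
Qed.

Lemma uniform_steps_ge0 g : 0 <= uniform_steps g.
Proof. by apply: sumr_ge0 => i _; rewrite mulr_ge0// invr_ge0. Qed.

Lemma msupport_uniform_steps : msupport uniform_steps = range gen.
Proof.
apply/seteqP; split=> [g|_ [i _ <-]]; rewrite /msupport/=.
  apply: contra_neqP => ng; rewrite /uniform_steps big1// => i _.
  by case: eqP => [ig|_]; [case: ng; exists i|rewrite mul0r].
have I0 : 0 < #|I|%:R^-1 :> R by rewrite invr_gt0 ltr0n; apply/card_gt0P; exists i.
rewrite gt_eqF// /uniform_steps (bigD1 i)//= eqxx mul1r ltr_pwDl//.
by apply: sumr_ge0 => j _; rewrite mulr_ge0// invr_ge0.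
Qed.

Lemma uniform_steps_probability :
  (0 < #|I|)%N -> finsupp_probability uniform_steps.
Proof.
move=> I0; split; first by rewrite msupport_uniform_steps; exact: finite_image.
  exact: uniform_steps_ge0.
rewrite (eq_fsbigr (fun h : G => 1 * uniform_steps h)); last first.
  by move=> h _; rewrite mul1r.
rewrite (sum_uniform_steps (fun=> 1)) sumr_const mul1r -[LHS]mulr_natl divff//.
by rewrite pnatr_eq0 -lt0n.
Qed.

Lemma uniform_steps_symmetric (opp : I -> I) : involutive opp ->
  (forall i, gen (opp i) = (gen i)^-1)%g -> symmetric_measure uniform_steps.
Proof.
move=> oppK genV g; rewrite /uniform_steps (reindex_inj (inv_inj oppK))/=.
by apply: eq_bigr => i _; rewrite genV (can2_eq invgK invgK).
Qed.

Lemma return_prob_uniform_steps n :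
  return_prob uniform_steps n =
  #|[pred t : n.-tuple I | (\prod_(i <- t) gen i)%g == 1%g]|%:R / #|I|%:R ^+ n.
Proof.
pose e (v : {ffun 'I_n -> I}) := [tuple gen (v i) | i < n].
rewrite /return_prob /steps_prob.
rewrite (eq_fsbigr (fun w : n.-tuple G =>
    \sum_v (e v == w)%:R * #|I|%:R ^- n)); last first.
  move=> w _; rewrite bigA_distr_bigA/=; apply: eq_bigr => v _.
  rewrite big_split/= prodr_const card_ord -exprVn; congr (_ * _).
  case: eqP => [<-|ne].
    by rewrite big1// => i _; rewrite tnth_mktuple eqxx.
  apply/eqP/prodf_eq0; apply: contra_notP ne => ev.
  apply: eq_from_tnth => i; rewrite tnth_mktuple; apply/eqP.
  by apply: contra_notT ev => ev; exists i; rewrite // (negbTE ev).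
rewrite fsbig_pushforward.
rewrite (reindex (fun t : n.-tuple I => [ffun i => tnth t i]))/=; last first.
  exists (fun v : {ffun 'I_n -> I} => [tuple v i | i < n]) => [t _|v _].
    by apply: eq_from_tnth => i; rewrite tnth_mktuple ffunE.
  by apply/ffunP => i; rewrite ffunE tnth_mktuple.
rewrite sumr_const -[LHS]mulr_natl; congr (_%:R * _); apply: eq_card => t.
rewrite !inE big_tuple; apply/asboolP/eqP; rewrite /e /walk/=.
  by under eq_bigr do rewrite tnth_mktuple ffunE.
by under [in X in _ -> X]eq_bigr do rewrite tnth_mktuple ffunE.
Qed.

End UniformSteps.

(** * The subgroup generated by a set, as a group *)

Section GeneratedSubgroup.
Variables (W : groupType) (S : set W).

Definition in_generated : pred W := fun x => `[< subgroup_generated S x >].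

Lemma in_generated_closed : group_closed in_generated.
Proof.
split.
  by apply/asboolP => H [[H1 _] _]; exact: set_mem H1.
move=> x y /asboolP xS /asboolP yS; apply/asboolP => H Hgen.
have [[_ HF] _] := Hgen.
by apply: set_mem (HF x y _ _); apply: mem_set; [exact: xS|exact: yS].
Qed.

Record generated : Type := Generated { generated_val : W; _ : in_generated generated_val }.

HB.instance Definition _ := [isSub for generated_val].
HB.instance Definition _ := [Choice of generated by <:].
HB.instance Definition _ :=
  SubChoice_isSubGroup.Build W in_generated generated in_generated_closed.

Lemma mem_generated x : S x -> in_generated x.
Proof. by move=> Sx; apply/asboolP => H [_ SH]; exact: SH. Qed.

Lemma generated_by_gens : subgroup_generated [set x : generated | S (val x)] = [set: generated].
Proof.
apply/seteqP; split=> // x _ H [Hgr SH].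
(* Push [H] forward to the ambient group, where the generators live. *)
pose K : set W := [set w | exists2 y : generated, H y & val y = w].
suff : K (val x) by move=> [y Hy /val_inj <-].
have /asboolP := valP x; apply; split=> [|w Sw]; last first.
  by exists (Generated (mem_generated Sw)) => //; exact: SH.
have [H1 HF] := Hgr; split.
  by apply: mem_set; exists 1%g; [exact: set_mem H1|exact: val1].
move=> a b /set_mem[a' Ha <-] /set_mem[b' Hb <-].
apply: mem_set; exists (a' / b')%g; last by rewrite gmulfF.
by apply: set_mem (HF a' b' _ _); exact: mem_set.
Qed.

End GeneratedSubgroup.

(** * Marks, and a potential whose slope is halved at each mark *)

(** The gaps are as long as possible for the sum of [gap j / 2^j] to converge,
    up to the choice of the summable sequence [1 / (j+1)^2]; the successor makes
    them positive. *)
Definition gap (j : nat) : nat := (2 ^ j %/ j.+1 ^ 2).+1.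

(** [mark 0 = 0] is the origin; the actual marks are the [mark j.+1]. *)
Definition mark (j : nat) : nat := \sum_(i < j) gap i.

Lemma markS j : mark j.+1 = (mark j + gap j)%N.
Proof. by rewrite /mark big_ord_recr. Qed.

Lemma mark_lt j : (mark j < mark j.+1)%N.
Proof. by rewrite markS -addn1 leq_add2l. Qed.

Lemma mark_homo : {homo mark : i j / (i < j)%N}.
Proof. exact: homo_ltn ltn_trans mark_lt. Qed.

Lemma leq_mark : {mono mark : i j / (i <= j)%N}.
Proof. exact: leq_mono mark_homo. Qed.

Definition is_mark (n : nat) : bool := `[< exists j, n = mark j.+1 >].

Lemma is_markP j n : (mark j < n <= mark j.+1)%N -> is_mark n = (n == mark j.+1).
Proof.
move=> /andP[jn nj]; apply/asboolP/eqP => [[i ni]|->]; last by exists j.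
apply/eqP; rewrite eqn_leq nj ni leq_mark ltnS.
by move: jn; rewrite ni ltnNge leq_mark -ltnNge.
Qed.

Section Potential.
Variable R : realType.

Fixpoint slope (n : nat) : R :=
  if n is m.+1 then (if is_mark m.+1 then slope m / 2 else slope m) else 1.

Fixpoint pot (n : nat) : R := if n is m.+1 then pot m + slope m else 0.

Lemma slope_gt0 n : 0 < slope n.
Proof. by elim: n => //= n IHn; case: ifP => // _; rewrite divr_gt0. Qed.

Lemma pot_homo : {homo pot : m n / (m <= n)%N >-> m <= n}.
Proof.
apply: (homo_leq (@lexx _ R)) => [x y z|n /=]; first exact: le_trans.
by rewrite lerDl ltW// slope_gt0.
Qed.

Lemma pot_ge0 n : 0 <= pot n.
Proof. exact: (pot_homo (leq0n n)). Qed.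

Lemma slope_mark j i : (i < gap j)%N -> slope (mark j + i) = 2^-1 ^+ j.
Proof.
elim: j i => [|j IHj].
  elim=> [|i IHi] ilt; first by rewrite /mark big_ord0.
  rewrite addnS /= IHi 1?ltnW// (@is_markP 0); last by rewrite markS; lia.
  by rewrite markS ifF//; lia.
elim=> [|i IHi] ilt; last first.
  rewrite addnS /= IHi 1?ltnW// (@is_markP j.+1); last by rewrite (markS j.+1); lia.
  by rewrite (markS j.+1) ifF//; lia.
have markSq : mark j.+1 = (mark j + (gap j).-1).+1 by rewrite markS /gap addnS.
rewrite addn0 markSq /= IHj // -markSq (@is_markP j) ?mark_lt ?leqnn//.
by rewrite eqxx exprSr.
Qed.

Lemma pot_mark j : pot (mark j) = \sum_(i < j) (gap i)%:R * 2^-1 ^+ i.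
Proof.
elim: j => [|j IHj]; first by rewrite /mark !big_ord0.
rewrite big_ord_recr -IHj markS /=.
suff aux i : (i <= gap j)%N -> pot (mark j + i) = pot (mark j) + i%:R * 2^-1 ^+ j.
  exact: aux.
elim: i => [|i IHi] ilt; first by rewrite addn0 mul0r addr0.
by rewrite addnS /= IHi 1?ltnW// slope_mark// -addrA -[in RHS](natr1 i) mulrDl mul1r.
Qed.

Lemma gap_le (j : nat) : (gap j)%:R * 2^-1 ^+ j <= (j.+1%:R ^+ 2)^-1 + 2^-1 ^+ j :> R.
Proof.
rewrite /gap -(natr1 (_ %/ _)) mulrDl mul1r lerD2r exprVn ler_pdivrMr ?exprn_gt0//.
rewrite mulrC ler_pdivlMr ?exprn_gt0// -!natrX -natrM ler_nat.
exact: leq_trunc_div.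
Qed.

(** The increments of the potential over the gaps are at most
    [1/(j+1)^2 + 1/2^j], and [1/(j+1)^2] is at most [1/j - 1/(j+1)], whence the
    telescoping bound [4 - 1/n - 2/2^n] proved by induction. *)
Lemma pot_le4 n : pot n <= 4.
Proof.
have nm : (n <= mark n.+1)%N.
  elim: n => [//|n IHn]; exact: leq_ltn_trans IHn (mark_lt _).
apply: le_trans (pot_homo nm) _; rewrite pot_mark.
suff: \sum_(i < n.+1) (gap i)%:R * 2^-1 ^+ i <= 4 - n.+1%:R^-1 - 2 * 2^-1 ^+ n.+1 :> R.
  move=> /le_trans; apply; rewrite -addrA gerDl -opprD oppr_le0.
  by rewrite addr_ge0 ?invr_ge0// mulr_ge0// exprn_ge0// invr_ge0.
elim: n {nm} => [|n IHn].
  by rewrite big_ord1 (_ : gap 0 = 2)// expr0 expr1 invr1; lra.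
rewrite big_ord_recr /=; apply: le_trans (lerD IHn (gap_le _)) _.
have n1 : 0 < n.+1%:R :> R by [].
have : (n.+2%:R ^+ 2)^-1 <= n.+1%:R^-1 - n.+2%:R^-1 :> R.
  rewrite -(natr1 n.+1); set x : R := n.+1%:R.
  have -> : x^-1 - (x + 1)^-1 = (x * (x + 1))^-1.
    by field; rewrite !gt_eqF// ?ltr_wpDl// ltW.
  by rewrite lef_pV2 ?posrE ?expr2 ?mulr_gt0 ?addr_gt0//; rewrite ler_pM2r ?addr_gt0// lerDl.
rewrite (exprS _ n.+1); move: (2^-1 ^+ _) (_ ^- 2) (n.+1%:R^-1) (n.+2%:R^-1) => x y z t; lra.
Qed.

Definition zpot (k : int) : R := if k is Posz n then pot n else 0.

Lemma zpot_affine (n : nat) :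
  ~~ is_mark n.+1 -> zpot (n.+1%:Z + 1) + zpot (n.+1%:Z - 1) = 2 * zpot n.+1.
Proof.
move=> nm; have -> : n.+1%:Z + 1 = n.+2 by lia.
have -> : n.+1%:Z - 1 = n by lia.
by rewrite /= (negbTE nm); lra.
Qed.

Lemma zpot_kink (n : nat) : is_mark n.+1 ->
  2 * zpot (n.+1%:Z + 1) + zpot (n.+1%:Z - 1) = 3 * zpot n.+1.
Proof.
move=> nm; have -> : n.+1%:Z + 1 = n.+2 by lia.
have -> : n.+1%:Z - 1 = n by lia.
by rewrite /= nm; lra.
Qed.

Lemma zpot_ge0 k : 0 <= zpot k.
Proof. by case: k => n //=; exact: pot_ge0. Qed.

Lemma zpot_le4 k : zpot k <= 4.
Proof. by case: k => n //=; exact: pot_le4. Qed.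

(** * The height of a base configuration *)

(** The furthest lit mark; [T = 0] stands for no lit mark. *)
Definition is_top (phi : int -> bool) (T : nat) : Prop :=
  (forall j, phi (mark j.+1) -> (mark j.+1 <= T)%N) /\
  (T = 0%N \/ exists2 j, T = mark j.+1 & phi (mark j.+1)).

Lemma is_top_uniq phi T T' : is_top phi T -> is_top phi T' -> T = T'.
Proof.
move=> [leT T0] [leT' T0']; apply/eqP; rewrite eqn_leq; apply/andP; split.
  by case: T0 => [->|[j -> /leT']].
by case: T0' => [->|[j -> /leT]].
Qed.

Lemma is_top_ex (phi : int -> bool) K : (forall j, phi (mark j.+1) -> (mark j.+1 <= K)%N) ->
  exists2 T, is_top phi T & (T <= K)%N.
Proof.
elim: K => [|K IHK] leK; first by exists 0%N => //; split=> //; left.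
have [[j Kj pj]|nK] := pselect (exists2 j, K.+1 = mark j.+1 & phi (mark j.+1)).
  by exists K.+1 => //; split=> //; right; exists j.
have [|T topT TK] := IHK; last by exists T => //; exact: leqW.
move=> j pj; have := leK _ pj; rewrite leq_eqVlt ltnS => /orP[/eqP jK|//].
by case: nK; exists j.
Qed.

(** A configuration can light infinitely many marks, in which case the height is
    set to zero; flipping one lamp does not leave or enter that case, so
    harmonicity holds there trivially. *)
Definition height (phi : int -> bool) (n : int) : R :=
  if `[< exists T, is_top phi T >] then
    zpot (Num.max n (xget 0%N [set T | is_top phi T])%:Z)
  else 0.

Lemma heightE phi T n : is_top phi T -> height phi n = zpot (Num.max n T%:Z).
Proof.
move=> topT; rewrite /height ifT; last by apply/asboolP; exists T.
by case: xgetP => [T' _ /is_top_uniq/(_ topT) ->|/(_ T)].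
Qed.

Lemma height_none phi n : ~ (exists T, is_top phi T) -> height phi n = 0.
Proof. by move=> nT; rewrite /height; case: asboolP. Qed.

Lemma height_bound phi n : `|height phi n| <= 4.
Proof.
rewrite /height; case: ifP => _; last by rewrite normr0.
by rewrite ger0_norm ?zpot_ge0// zpot_le4.
Qed.

Definition flip_at (phi : int -> bool) (n : int) (a : bool) : int -> bool :=
  fun k => phi k (+) (a && (k == n)).

Lemma is_top_flip phi (n : int) a T : ~ (exists j, n = mark j.+1) ->
  is_top phi T -> is_top (flip_at phi n a) T.
Proof.
move=> nn [leT T0].
have E j : flip_at phi n a (mark j.+1) = phi (mark j.+1).
  by rewrite /flip_at; case: eqP => [e|]; [case: nn; exists j|rewrite andbF addbF].
split=> [j|]; first by rewrite E; exact: leT.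
by case: T0 => [|[j Tj pj]]; [left|right; exists j; rewrite ?E].
Qed.

Lemma flip_atK phi n a : flip_at (flip_at phi n a) n a = phi.
Proof. by apply/funext => k; rewrite /flip_at -addbA addbb addbF. Qed.

Lemma flip_at_bounded phi n a :
  (exists T, is_top (flip_at phi n a) T) <-> (exists T, is_top phi T).
Proof.
suff imp psi : (exists T, is_top psi T) -> exists T, is_top (flip_at psi n a) T.
  by split=> [/imp|/imp //]; rewrite flip_atK.
move=> [T [leT _]]; have [j|T' topT' _] := @is_top_ex (flip_at psi n a) (maxn T `|n|).
  rewrite /flip_at; case: eqP => [<-|_]; first by rewrite leq_maxr.
  by rewrite andbF addbF => /leT /leq_trans -> //; rewrite leq_maxl.
by exists T'.
Qed.

Lemma is_top_flip_lt phi n a T : is_top phi T -> n < T%:Z ->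
  is_top (flip_at phi n a) T.
Proof.
move=> [leT T0] nT; split=> [j|].
  rewrite /flip_at; case: eqP => [jn _|_]; first by move: nT; rewrite -jn; lia.
  by rewrite andbF addbF; exact: leT.
case: T0 => [|[j Tj pj]]; [by left|right; exists j => //].
by rewrite /flip_at pj; case: eqP => [|]; rewrite ?andbF//; lia.
Qed.

(** The two possible states of the lamp under the cursor are averaged, then the
    cursor moves.  Below the top mark everything is constant, and above it and
    off the marks the potential is affine.  At a mark beyond which no lamp is
    lit, the two steps outwards give [pot (n+1)], and the step inwards gives
    [pot n] if the lamp has just been lit and [pot (n-1)] if not; the average is
    [pot n] because the slope is halved there.  The origin is excluded when
    no mark is lit because the potential has a kink there. *)
Lemma height_harmonic (phi : int -> bool) (n : int) :
  ~ (n = 0 /\ forall j, ~~ phi (mark j.+1)) ->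
  \sum_a (height (flip_at phi n a) (n + 1) + height (flip_at phi n a) (n - 1)) =
  4 * height phi n.
Proof.
move=> no; have [[T topT]|nT] := pselect (exists T, is_top phi T); last first.
  rewrite big1 => [|a _]; rewrite !height_none ?mulr0 ?addr0//.
    by rewrite flip_at_bounded.
  by rewrite flip_at_bounded.
have [nT|Tn] := ltP n T%:Z.
  rewrite (eq_bigr (fun=> 2 * zpot T)) => [|a _]; last first.
    by rewrite !(heightE _ (is_top_flip_lt a topT nT)) !max_r; [ring|lia|lia].
  rewrite big_bool (heightE _ topT) max_r ?ltW//=; ring.
have [[j nj]|nm] := pselect (exists j, n = mark j.+1); last first.
  rewrite (eq_bigr (fun=> zpot (Num.max (n + 1) T%:Z) + zpot (Num.max (n - 1) T%:Z)))
      => [|a _]; last by rewrite !(heightE _ (is_top_flip a nm topT)).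
  rewrite big_bool (heightE _ topT) /=.
  have T_lt_n : (T%:Z < n).
    rewrite lt_neqAle Tn andbT; apply/eqP => Tn'; move: topT => [leT [T0|[j Tj _]]].
      apply: no; split; first by rewrite -Tn' T0.
      by move=> j; apply/negP => /leT; rewrite T0 leqNgt (leq_ltn_trans _ (mark_lt _)).
    by apply: nm; exists j; rewrite -Tn' Tj.
  rewrite !max_l; try lia.
  case: n no Tn T_lt_n nm => [[|n]|n] _ _; try lia.
  move=> _ nm; have nm' : ~~ is_mark n.+1.
    by apply/asboolP => -[j nj]; apply: nm; exists j; rewrite nj.
  by have := zpot_affine nm'; lra.
pose off k := phi k && (k != n); pose on k := phi k || (k == n).
have -> : \sum_a (height (flip_at phi n a) (n + 1) + height (flip_at phi n a) (n - 1)) =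
   (height on (n + 1) + height on (n - 1)) + (height off (n + 1) + height off (n - 1)).
  rewrite big_bool /=; case pn: (phi n).
    have -> : flip_at phi n true = off.
      apply/funext => k; rewrite /flip_at /off /=.
      by case: eqP => [->|]; rewrite ?pn ?andbF ?andbT ?addbF.
    have -> // : flip_at phi n false = on.
      apply/funext => k; rewrite /flip_at /on /=.
      by case: eqP => [->|]; rewrite ?pn ?addbF ?orbF.
    exact: addrC.
  have -> : flip_at phi n true = on.
    apply/funext => k; rewrite /flip_at /on /=.
    by case: eqP => [->|]; rewrite ?pn ?orbF ?addbF.
  have -> // : flip_at phi n false = off.
  apply/funext => k; rewrite /flip_at /off /=.
  by case: eqP => [->|]; rewrite ?pn ?andbT ?addbF.
have [leT _] := topT.
have topon : is_top on (mark j.+1).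
  split=> [i|]; last by right; exists j; rewrite // /on nj eqxx orbT.
  rewrite /on nj => /orP[/leT|/eqP[->]//]; move: Tn; rewrite nj; lia.
have mj : (mark j.+1 = (mark j.+1).-1.+1)%N by have := mark_lt j; lia.
have [i|T' topT' T'n] := @is_top_ex off (mark j.+1).-1.
  rewrite /off => /andP[/leT iT /eqP]; move: Tn; rewrite nj; lia.
rewrite (heightE _ topT) !(heightE _ topon) !(heightE _ topT') nj.
rewrite (@max_r _ _ ((mark j.+1)%:Z - 1) (mark j.+1)); last by lia.
rewrite !max_l; try (move: Tn; lia).
have := @zpot_kink (mark j.+1).-1; rewrite -mj.
have -> : is_mark (mark j.+1) by apply/asboolP; exists j.
by move=> /(_ isT); lra.
Qed.

End Potential.

(** * The permutational wreath product *)

(** The coset space [H / K]: a cursor and one bit for each mark. *)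
Definition site : Type := (int * (nat -> bool))%type.

(** The action of the lamplighter [(phi, n)] on the coset of [(psi, m)]: the bit
    of mark [d] is the value of the product configuration at the new cursor
    shifted by [d]. *)
Definition act (phi : int -> bool) (n : int) (s : site) : site :=
  (n + s.1, fun j => s.2 j (+) phi (n + s.1 + (mark j.+1)%:Z)).

Definition unact (phi : int -> bool) (n : int) (s : site) : site :=
  (s.1 - n, fun j => s.2 j (+) phi (s.1 + (mark j.+1)%:Z)).

Lemma actK phi n : cancel (act phi n) (unact phi n).
Proof.
move=> [m y]; rewrite /unact /act/=; congr (_, _); first by rewrite addrC addKr.
by apply/funext => j; rewrite -addbA addbb addbF.
Qed.

Lemma unactK phi n : cancel (unact phi n) (act phi n).
Proof.
move=> [m y]; rewrite /unact /act/= addrC subrK; congr (_, _).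
by apply/funext => j; rewrite -addbA addbb addbF.
Qed.

(** The unrestricted wreath product, in which the finitely generated group is
    carved out; finiteness of supports is thus never part of the data. *)
Record switcher : Type :=
  Switcher { lamps : site -> bool; base : int -> bool; cursor : int }.

HB.instance Definition _ := gen_eqMixin switcher.
HB.instance Definition _ := gen_choiceMixin switcher.

Lemma switcher_ext g h : lamps g =1 lamps h -> base g =1 base h ->
  cursor g = cursor h -> g = h.
Proof.
by case: g h => [P p n] [Q q m] /= /funext-> /funext-> ->.
Qed.

Definition switcher_one : switcher := Switcher (fun=> false) (fun=> false) 0.

Definition switcher_mul (g h : switcher) : switcher :=
  Switcher (fun s => lamps g s (+) lamps h (unact (base g) (cursor g) s))
    (fun k => base g k (+) base h (k - cursor g)) (cursor g + cursor h).

Definition switcher_inv (g : switcher) : switcher :=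
  Switcher (fun s => lamps g (act (base g) (cursor g) s))
    (fun k => base g (k + cursor g)) (- cursor g).

Lemma unactM g h s :
  unact (base (switcher_mul g h)) (cursor (switcher_mul g h)) s =
  unact (base h) (cursor h) (unact (base g) (cursor g) s).
Proof.
rewrite /unact/= opprD addrA; congr (_, _); apply/funext => j.
by rewrite addbA; congr (_ (+) base h _); rewrite addrAC.
Qed.

Lemma unact1 s : unact (base switcher_one) (cursor switcher_one) s = s.
Proof.
by case: s => m y; rewrite /unact/= subr0; congr pair; apply/funext => j;
   rewrite addbF.
Qed.

Lemma unactV g s :
  unact (base (switcher_inv g)) (cursor (switcher_inv g)) s =
  act (base g) (cursor g) s.
Proof.
rewrite /unact /act/= opprK addrC; congr pair; apply/funext => j.
by rewrite (addrC (cursor g)) addrAC.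
Qed.

Lemma switcher_mulA : associative switcher_mul.
Proof.
move=> g h k; apply: switcher_ext => [s|j|] /=; last exact: addrA.
  by rewrite unactM addbA.
by rewrite addbA opprD addrA.
Qed.

Lemma switcher_mul1 : left_id switcher_one switcher_mul.
Proof.
move=> g; apply: switcher_ext => [s|j|] /=; last exact: add0r.
  by rewrite unact1.
by rewrite subr0.
Qed.

Lemma switcher_mulr1 : right_id switcher_one switcher_mul.
Proof.
by move=> g; apply: switcher_ext => [s|j|] /=; rewrite ?addbF ?addr0.
Qed.

Lemma switcher_mulV : left_inverse switcher_one switcher_inv switcher_mul.
Proof.
move=> g; apply: switcher_ext => [s|j|] /=; last exact: addNr.
  by rewrite unactV addbb.
by rewrite opprK addbb.
Qed.

Lemma switcher_mulrV : right_inverse switcher_one switcher_inv switcher_mul.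
Proof.
move=> g; apply: switcher_ext => [s|j|] /=; last exact: addrN.
  by rewrite unactK addbb.
by rewrite subrK addbb.
Qed.

HB.instance Definition _ := isGroup.Build switcher switcher_mulA switcher_mul1
  switcher_mulr1 switcher_mulV switcher_mulrV.

Definition root : site := (0, fun=> false).

Definition flip (a : bool) : switcher :=
  Switcher (fun=> false) (fun k => a && (k == 0)) 0.

Definition switch (b : bool) : switcher :=
  Switcher (fun s => b && `[< s = root >]) (fun=> false) 0.

Definition shift (e : bool) : switcher :=
  Switcher (fun=> false) (fun=> false) (if e then 1 else -1).

(** Right multiplications act locally: [flip] on the base lamp under the cursor,
    [switch] on the upper lamp at the image of the root, [shift] on the
    cursor. *)
Lemma mul_flip g a : (g * flip a)%g =
  Switcher (lamps g) (flip_at (base g) (cursor g) a) (cursor g).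
Proof.
by apply: switcher_ext => [s|k|] /=; rewrite ?addbF ?addr0// /flip_at subr_eq0.
Qed.

Lemma mul_switch g b : (g * switch b)%g =
  Switcher (fun s => lamps g s (+)
                     (b && `[< s = act (base g) (cursor g) root >]))
    (base g) (cursor g).
Proof.
apply: switcher_ext => [s|k|] /=; rewrite ?addbF ?addr0//.
congr (_ (+) (b && _)); apply/asboolP/asboolP => [<-|->]; first by rewrite unactK.
by rewrite actK.
Qed.

Lemma mul_shift g e : (g * shift e)%g =
  Switcher (lamps g) (base g) (cursor g + if e then 1 else -1).
Proof.
by apply: switcher_ext => [s|k|] /=; rewrite ?addbF ?addr0.
Qed.

Lemma flipV a : (flip a)^-1%g = flip a.
Proof. by apply: switcher_ext => [s|k|] /=; rewrite ?addr0 ?oppr0. Qed.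

Lemma switchV b : (switch b)^-1%g = switch b.
Proof.
apply: switcher_ext => [s|k|] /=; rewrite ?addr0 ?oppr0//.
by rewrite -[in RHS](unactK (fun=> false) 0 s) unact1.
Qed.

Lemma shiftV e : (shift e)^-1%g = shift (~~ e).
Proof. by apply: switcher_ext => [s|k|] //=; case: e; rewrite /= ?opprK. Qed.

(** One step of the walk: randomise both lamps, move the cursor, and randomise
    again in the mirror order, so that the inverse of a step is a step. *)
Definition step : Type := (bool * bool * bool * (bool * bool))%type.
HB.instance Definition _ := Finite.on step.

Definition gen (i : step) : switcher :=
  let: (a, b, e, (b', a')) := i in
  (flip a * switch b * shift e * switch b' * flip a')%g.

Definition rev_step (i : step) : step :=
  let: (a, b, e, (b', a')) := i in (a', b', ~~ e, (b, a)).

Lemma rev_stepK : involutive rev_step.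
Proof. by move=> [[[a b] e] [b' a']] /=; rewrite negbK. Qed.

Lemma gen_rev i : gen (rev_step i) = (gen i)^-1%g.
Proof.
by case: i => [[[a b] e] [b' a']] /=; rewrite !invgM !flipV !switchV shiftV !mulgA.
Qed.

Lemma card_step : #|{: step}| = 32.
Proof. by rewrite !card_prod !card_bool. Qed.

(** * A bounded harmonic function *)

Section SignedHeight.
Variable R : realType.

Definition signed_height (g : switcher) : R :=
  (-1) ^+ lamps g root * height R (base g) (cursor g).

Lemma signed_height_bound g : `|signed_height g| <= 4.
Proof. by rewrite /signed_height normrMsign height_bound. Qed.

Lemma flip_at_mark phi (n : int) a j : flip_at phi n a (n + (mark j.+1)%:Z) =
  phi (n + (mark j.+1)%:Z).
Proof.
rewrite /flip_at; case: eqP; rewrite ?andbF ?addbF//.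
by have := mark_lt j; lia.
Qed.

(** The lamp under the cursor cannot raise the height above [pot n], which is
    already reached by the cursor itself. *)
Lemma height_flip phi (n : int) a :
  height R (flip_at phi n a) n = height R phi n.
Proof.
have [[T topT]|nT] := pselect (exists T, is_top phi T); last first.
  by rewrite !height_none// flip_at_bounded.
have [nT|] := ltP n T%:Z.
  by rewrite (heightE _ _ topT) (heightE _ _ (is_top_flip_lt a topT nT)).
case: n => // n Tn; have [leT _] := topT.
have [j|T' topT' T'n] := @is_top_ex (flip_at phi n a) n.
  rewrite /flip_at; case: eqP => [[->]//|_]; rewrite andbF addbF => /leT.
  by move: Tn; lia.
by rewrite (heightE _ _ topT) (heightE _ _ topT') !max_l.
Qed.

Definition at_root (phi : int -> bool) (n : int) : Prop :=
  n = 0 /\ forall j, ~~ phi (mark j.+1).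

Lemma act_root phi n : root = act phi n root <-> at_root phi n.
Proof.
rewrite /act /root /= addr0; split=> [[n0 phi0]|[-> phi0]].
  split=> // j; have := congr1 (fun y => y j) phi0 => /=.
  by rewrite -n0 add0r => <-.
by congr pair; apply/funext => j; rewrite add0r (negbTE (phi0 j)).
Qed.

Lemma height_at_root phi n : at_root phi n -> height R phi n = 0.
Proof.
move=> [-> phi0]; have top0 : is_top phi 0.
  by split=> [j|]; [rewrite (negbTE (phi0 j))|left].
by rewrite (heightE _ _ top0) maxxx.
Qed.

Lemma at_root_flip phi n a : at_root (flip_at phi n a) n <-> at_root phi n.
Proof.
split=> -[n0 phi0]; split=> // j; have := phi0 j; have := @flip_at_mark phi n a j;
  by rewrite n0 add0r => ->.
Qed.

Lemma signed_height_flip g a : signed_height (g * flip a)%g = signed_height g.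
Proof. by rewrite mul_flip /signed_height /= height_flip. Qed.

(** The switch only changes the sign when the cursor sits at the root with no
    mark lit, where the height vanishes. *)
Lemma signed_height_switch g b : signed_height (g * switch b)%g = signed_height g.
Proof.
rewrite mul_switch /signed_height /=; case: asboolP => [/act_root gr|_].
  by rewrite height_at_root// !mulr0.
by rewrite andbF addbF.
Qed.

Lemma sum_step (F : step -> R) :
  \sum_i F i = \sum_a \sum_b \sum_e \sum_b' \sum_a' F (a, b, e, (b', a')).
Proof.
rewrite !pair_bigA /=.
rewrite (reindex (fun i : bool * bool * bool * bool * bool =>
    (i.1.1, (i.1.2, i.2)) : step)); first by apply: eq_bigr => -[[[[]]]].
exists (fun i : step => (i.1, i.2.1, i.2.2)) => [[[abe b] a]|[abe [b a]]] _ //=.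
Qed.

(** Away from the root the sign is constant along the step and the average is
    that of the height; at the root the value is zero and the two states of the
    switch contribute opposite values. *)
Lemma signed_height_harmonic g :
  \sum_i signed_height (g * gen i)%g = 32 * signed_height g.
Proof.
rewrite sum_step /gen.
under eq_bigr => a _. under eq_bigr => b _. under eq_bigr => e _.
  under eq_bigr => b' _. under eq_bigr => a' _.
    rewrite !mulgA signed_height_flip signed_height_switch mul_shift mul_switch.
    rewrite mul_flip /signed_height /=.
  over. over. over. over. over.
rewrite /=.
have [gr|ngr] := pselect (at_root (base g) (cursor g)).
  rewrite /signed_height (height_at_root gr) !mulr0 big1// => a _.
  have -> : `[< root = act (flip_at (base g) (cursor g) a) (cursor g) root >].
    by apply/asboolP/act_root/at_root_flip.
  rewrite !big_bool /=; case: (lamps g root); rewrite /= ?expr1 ?expr0; ring.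
rewrite (eq_bigr (fun a => (-1) ^+ lamps g root * 8 *
   (height R (flip_at (base g) (cursor g) a) (cursor g + 1) +
    height R (flip_at (base g) (cursor g) a) (cursor g - 1)))) => [|a _].
  by rewrite -mulr_sumr height_harmonic// /signed_height; ring.
case: asboolP => [/act_root/at_root_flip //|_].
by rewrite !big_bool /= ?andbF ?addbF; ring.
Qed.

Lemma signed_height_nonconstant :
  signed_height (gen (false, false, true, (false, false))) <> signed_height 1%g.
Proof.
rewrite /gen signed_height_flip signed_height_switch mul_shift mul_switch.
have top0 (phi : int -> bool) : (forall k, phi k = false) -> is_top phi 0.
  by move=> phi0; split=> [j|]; [rewrite phi0|left].
rewrite /signed_height /= !(heightE _ _ (top0 _ _)) //=.
by rewrite mulr0 add0r expr0 mulr1; apply/eqP; rewrite oner_eq0.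
Qed.

End SignedHeight.

(** * Confinement of the simple random walk on the integers *)

Section Confinement.
Variables (I : finType) (dir : I -> int) (r : nat).

Fixpoint confined (k : int) (s : seq I) : bool :=
  (`|k| <= r)%N && (if s is i :: s' then confined (k + dir i) s' else true).

Variable R : realType.

(** Over [|k| <= r], a polynomial substitute for the principal Dirichlet
    eigenfunction [cos (pi k / 2 r)].  Squaring [r^2 - k^2] makes it convex near
    the end points, where its small values could not absorb a negative second
    difference. *)
Definition bump (k : int) : R :=
  if (`|k| <= r)%N then (r%:R ^+ 2 - k%:~R ^+ 2) ^+ 2 else 0.

Lemma intr_sqr (k : int) : k%:~R ^+ 2 = `|k|%:R ^+ 2 :> R.
Proof. by case: k => n //; rewrite NegzE mulrNz sqrrN. Qed.

Lemma rate_ge0 : (3 <= r)%N -> 0 <= 1 - 5 / r%:R ^+ 2 :> R.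
Proof.
move=> r3; rewrite subr_ge0 ler_pdivrMr ?mul1r ?exprn_gt0 ?ltr0n//; last first.
  exact: leq_trans r3.
by rewrite -natrX ler_nat; apply: leq_trans (leq_mul r3 r3).
Qed.

Lemma bump_ge0 k : 0 <= bump k.
Proof. by rewrite /bump; case: ifP => // _; rewrite sqr_ge0. Qed.

Lemma bump_le k : bump k <= r%:R ^+ 4.
Proof.
rewrite /bump; case: ifP => [kr|_]; last by rewrite exprn_ge0.
have : k%:~R ^+ 2 <= r%:R ^+ 2 :> R.
  by rewrite intr_sqr ler_sqr ?nnegrE// ler_nat.
have := sqr_ge0 (k%:~R : R).
set x := k%:~R ^+ 2; set y := r%:R ^+ 2 => x0 xy.
have -> : r%:R ^+ 4 = y ^+ 2 by rewrite /y -exprM.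
by rewrite ler_sqr ?nnegrE ?subr_ge0 ?gerBl// (le_trans x0).
Qed.

(** With [x = k^2] and [y = r^2], the defect times [y] is
    [y + 3 y^2 - 4 x y + 5 x^2], the sum of [y] and a positive definite form. *)
Lemma bump_step k : (0 < r)%N ->
  (1 - 5 / r%:R ^+ 2) * bump k <= (bump (k + 1) + bump (k - 1)) / 2.
Proof.
move=> r0; have [kr|rk] := leqP r `|k|.
  have -> : bump k = 0.
    rewrite /bump; case: ifP => // kr'.
    have -> : k%:~R ^+ 2 = r%:R ^+ 2 :> R.
      by rewrite intr_sqr; congr (_%:R ^+ 2); apply/eqP; rewrite eqn_leq kr kr'.
    by rewrite subrr expr0n.
  by rewrite mulr0 divr_ge0// addr_ge0// bump_ge0.
rewrite /bump !ifT; try lia.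
rewrite -subr_ge0 intrD intrB.
set x := k%:~R; have : 0 < r%:R :> R by rewrite ltr0n.
set y := r%:R => y0.
suff -> : ((y ^+ 2 - (x + 1) ^+ 2) ^+ 2 + (y ^+ 2 - (x - 1) ^+ 2) ^+ 2) / 2 -
    (1 - 5 / y ^+ 2) * (y ^+ 2 - x ^+ 2) ^+ 2 =
    1 + ((4 * x ^+ 2 - 2 * y ^+ 2) ^+ 2 + 8 * (y ^+ 2) ^+ 2 + 4 * (x ^+ 2) ^+ 2 )
        / (4 * y ^+ 2).
  apply: addr_ge0 => //; apply: divr_ge0; last by rewrite mulr_ge0// sqr_ge0.
  by rewrite 2?addr_ge0 ?sqr_ge0 // mulr_ge0 ?sqr_ge0.
by field; rewrite gt_eqF.
Qed.

Lemma sum_tupleS n (F : n.+1.-tuple I -> R) :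
  \sum_t F t = \sum_i \sum_(t : n.-tuple I) F (cons_tuple i t).
Proof.
rewrite pair_bigA (reindex (fun p : I * n.-tuple I => cons_tuple p.1 p.2)) //=.
exists (fun t => (thead t, behead_tuple t)) => [[i t] _ /=|t _ /=].
  by congr (_, _); apply: val_inj.
by rewrite [RHS]tuple_eta; apply: val_inj.
Qed.

Definition num_confined (n : nat) (k : int) : R :=
  \sum_(t : n.-tuple I) (confined k t)%:R.

Lemma num_confinedS n k : (`|k| <= r)%N ->
  num_confined n.+1 k = \sum_i num_confined n (k + dir i).
Proof.
by move=> kr; rewrite /num_confined sum_tupleS /= kr.
Qed.

(** The increment is [1] or [-1], each for half of the letters. *)
Hypothesis dir_fair : forall F : int -> R,
  \sum_i F (dir i) = #|I|%:R * ((F 1 + F (-1)) / 2).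

(** [bump] is a subsolution of the walk killed outside [[-r, r]], with
    eigenvalue [1 - 5 / r^2], and it is at most [r^4]. *)
Lemma num_confined_ge n k : (3 <= r)%N ->
  (#|I|%:R * (1 - 5 / r%:R ^+ 2)) ^+ n * bump k <= r%:R ^+ 4 * num_confined n k.
Proof.
move=> r3; have rho0 := rate_ge0 r3.
elim: n k => [|n IHn] k.
  rewrite expr0 mul1r /num_confined (big_pred1 [tuple]) => [|t]; last first.
    by apply/esym/eqP; rewrite [LHS]tuple0.
  rewrite /= andbT; have [kr|kr] := boolP (_ <= _)%N; first by rewrite mulr1 bump_le.
  by rewrite mulr0 /bump (negbTE kr).
have [kr|kr] := boolP (`|k| <= r)%N; last first.
  by rewrite /bump (negbTE kr) mulr0 mulr_ge0 ?exprn_ge0// sumr_ge0.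
rewrite num_confinedS// mulr_sumr.
apply: le_trans (ler_sum _ (fun i _ => IHn (k + dir i))).
rewrite -mulr_sumr (dir_fair (fun x => bump (k + x))).
rewrite exprSr -mulrA ler_wpM2l ?exprn_ge0 ?mulr_ge0//.
by rewrite -mulrA ler_wpM2l// bump_step// (leq_trans _ r3).
Qed.

Lemma num_confined0_ge n : (3 <= r)%N ->
  (#|I|%:R * (1 - 5 / r%:R ^+ 2)) ^+ n <= num_confined n 0.
Proof.
move=> r3; have := num_confined_ge n 0 r3.
rewrite {1}/bump /= expr0n subr0 -exprM mulrC ler_pM2l// exprn_gt0// ltr0n.
exact: leq_trans r3.
Qed.

End Confinement.

(** * Counting the elements reached with a confined cursor *)

Definition dir (i : step) : int := let: (_, _, e, _) := i in if e then 1 else -1.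

Definition word (s : seq step) : switcher := (\prod_(i <- s) gen i)%g.

(** What a word reaches when its cursor stays in [[-r, r]]: both lamp
    configurations are then finite.  The upper lamps that can be lit sit at
    images of the root; there the bit of mark [d] is the base lamp at [n + d],
    which is off unless [n + d <= r], hence the bound [d <= 2r]. *)
Definition localized (r : nat) (g : switcher) : Prop :=
  [/\ (`|cursor g| <= r)%N,
      forall k, base g k -> (`|k| <= r)%N
    & forall s, lamps g s ->
        (`|s.1| <= r)%N /\ forall j, s.2 j -> (mark j.+1 <= r + r)%N].

Lemma localized1 r : localized r 1%g.
Proof. by split. Qed.

Lemma localized_flip r g a : localized r g -> localized r (g * flip a)%g.
Proof.
rewrite mul_flip => -[gr gb gl]; split=> //= k; rewrite /flip_at.
by have [->|_] := eqVneq k (cursor g); rewrite ?andbF ?addbF; [|exact: gb].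
Qed.

Lemma localized_switch r g b : localized r g -> localized r (g * switch b)%g.
Proof.
rewrite mul_switch => -[gr gb gl]; split=> //= s; case: asboolP => [-> _|_]; last first.
  by rewrite andbF addbF; exact: gl.
by rewrite /act /= addr0; split=> // j /gb; lia.
Qed.

Lemma localized_gen r g i : localized r g -> (`|(cursor g + dir i)%R| <= r)%N ->
  localized r (g * gen i)%g.
Proof.
case: i => [[[a b] e] [b' a']] gr er; rewrite /gen !mulgA.
apply/localized_flip/localized_switch.
have := localized_switch b (localized_flip a gr).
by rewrite mul_shift mul_switch mul_flip => -[_ gb gl]; split.
Qed.

Lemma cursor_gen g i : cursor (g * gen i)%g = cursor g + dir i.
Proof. by case: i => [[[a b] e] [b' a']] /=; rewrite !addr0 add0r. Qed.

Lemma localized_word r s : confined dir r 0 s -> localized r (word s).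
Proof.
suff H g : localized r g -> confined dir r (cursor g) s -> localized r (g * word s)%g.
  by move=> c; rewrite -[word s]mul1g; apply: H => //; exact: localized1.
elim: s g => [|i s IHs] g gr /=; first by rewrite /word big_nil mulg1.
move=> /andP[_]; rewrite /word big_cons mulgA -cursor_gen => c.
apply: IHs => //; apply: localized_gen => //.
by rewrite -cursor_gen; case: s c => [|? ?] /andP[].
Qed.

Section Code.
Variables (r J : nat).

(** A localized element is determined by finitely many bits if the marks from
    the [(J+1)]-st on lie beyond [2r]; integers of [[-r, r]] are shifted by
    [r]. *)
Definition code_type : Type :=
  ('I_(r + r).+1 * {ffun 'I_(r + r).+1 -> bool} *
   {ffun 'I_(r + r).+1 * {ffun 'I_J -> bool} -> bool})%type.
HB.instance Definition _ := Finite.on code_type.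

Lemma card_code_type : #|{: code_type}| =
  ((r + r).+1 * 2 ^ (r + r).+1 * 2 ^ ((r + r).+1 * 2 ^ J))%N.
Proof. by rewrite !card_prod !card_ffun !card_prod !card_ffun !card_ord !card_bool. Qed.

Definition extend (y : {ffun 'I_J -> bool}) (j : nat) : bool :=
  if insub j is Some j' then y j' else false.

Definition code (g : switcher) : code_type :=
  (inord `|(cursor g + r%:Z)%R|%N,
   [ffun i : 'I_(r + r).+1 => base g (i%:Z - r%:Z)],
   [ffun p : 'I_(r + r).+1 * {ffun 'I_J -> bool} =>
     lamps g (p.1%:Z - r%:Z, extend p.2)]).

Hypothesis Jr : (r + r < mark J.+1)%N.

Lemma ord_shift (k : int) : (`|k| <= r)%N ->
  exists i : 'I_(r + r).+1, k = i%:Z - r%:Z.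
Proof.
move=> kr; have lt : (`|(k + r%:Z)%R| < (r + r).+1)%N by lia.
by exists (Ordinal lt) => /=; lia.
Qed.

Lemma lamp_coded g s : localized r g -> lamps g s ->
  exists p : 'I_(r + r).+1 * {ffun 'I_J -> bool},
    s = (p.1%:Z - r%:Z, extend p.2).
Proof.
move=> [_ _ gl] /gl[/ord_shift[i si] sJ].
exists (i, [ffun j : 'I_J => s.2 j]).
rewrite [LHS]surjective_pairing si; congr pair; apply/funext => j.
rewrite /extend; case: insubP => [j' _ <-|]; first by rewrite ffunE.
rewrite -leqNgt => Jj; apply: contraTF isT => /sJ.
by rewrite leqNgt (leq_trans Jr)// leq_mark.
Qed.

Lemma code_inj g h : localized r g -> localized r h -> code g = code h -> g = h.
Proof.
move=> gloc hloc [/(congr1 val) ec /ffunP eb /ffunP el].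
have [gc gb _] := gloc; have [hc hb _] := hloc.
apply: switcher_ext => [s|k|].
- apply/idP/idP => ls.
    have [p sE] := lamp_coded gloc ls.
    by have := el p; rewrite !ffunE -sE ls => <-.
  have [p sE] := lamp_coded hloc ls.
  by have := el p; rewrite !ffunE -sE ls => ->.
- apply/idP/idP => bk.
    have /ord_shift[i ki] := gb _ bk.
    by have := eb i; rewrite !ffunE -ki bk => <-.
  have /ord_shift[i ki] := hb _ bk.
  by have := eb i; rewrite !ffunE -ki bk => ->.
- by move: ec; rewrite /= !inordK; lia.
Qed.

End Code.

(** Cauchy-Schwarz for the sizes of the fibres of [f]. *)
Lemma collisions (A C : finType) (P : pred A) (f : A -> C) :
  (#|P| ^ 2 <=
   #|C| * #|[pred p : A * A | [&& P p.1, P p.2 & f p.1 == f p.2]]|)%N.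
Proof.
pose m c := #|[pred a | P a & f a == c]|.
have cardP : #|P| = (\sum_c m c)%N.
  rewrite -sum1_card (partition_big f xpredT)//=; apply: eq_bigr => c _.
  by rewrite /m -[RHS]sum1_card.
have -> : #|[pred p : A * A | [&& P p.1, P p.2 & f p.1 == f p.2]]| = (\sum_c m c ^ 2)%N.
  rewrite -sum1_card (partition_big (fun p => f p.1) xpredT)//=.
  apply: eq_bigr => c _; rewrite -mulnn /m -!sum1_card big_distrlr /=.
  rewrite pair_big /=; apply: eq_bigl => -[a b] /=; rewrite !inE /=.
  by case: (P a) => //=; case: (P b); rewrite ?andbF//= andbC; case: eqP => // <-;
    rewrite eq_sym.
have -> : (#|P| ^ 2 = \sum_c \sum_c' m c * m c')%N by rewrite -mulnn cardP big_distrlr.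
rewrite -(leq_pmul2l (ltn0Sn 1)).
have -> : (2 * (#|C| * \sum_c m c ^ 2) = \sum_c \sum_c' (m c ^ 2 + m c' ^ 2))%N.
  rewrite mul2n -addnn; under [RHS]eq_bigr => c _ do rewrite big_split /= sum_nat_const.
  by rewrite big_split /= -big_distrr /= sum_nat_const.
rewrite big_distrr /=; apply: leq_sum => c _; rewrite big_distrr /=.
by apply: leq_sum => c' _; exact: nat_Cauchy.
Qed.

Lemma word_cat s t : word (s ++ t) = (word s * word t)%g.
Proof. exact: big_cat. Qed.

Lemma word_cons i s : word (i :: s) = (gen i * word s)%g.
Proof. exact: big_cons. Qed.

Lemma word_rev (s : seq step) : word (rev (map rev_step s)) = (word s)^-1%g.
Proof.
elim: s => [|i s IHs]; first by rewrite /word !big_nil invg1.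
rewrite /= rev_cons -cats1 word_cat IHs !word_cons invgM -gen_rev.
by rewrite [word [::]]big_nil mulg1.
Qed.

(** Two confined words [t] and [u] with the same code represent the same
    element, so [t] followed by the reverse of [u] is a loop. *)
Lemma card_loops (r J n : nat) : (r + r < mark J.+1)%N ->
  (#|[pred t : n.-tuple step | confined dir r 0 t]| ^ 2 <=
   #|{: code_type r J}| *
     #|[pred t : (2 * n).-tuple step | word t == 1%g]|)%N.
Proof.
move=> Jr; apply: leq_trans (collisions _ (fun t : n.-tuple step => code r J (word t))) _.
rewrite leq_mul2l; apply/orP; right.
have sz (p : n.-tuple step * n.-tuple step) :
    size (p.1 ++ rev (map rev_step p.2)) == (2 * n)%N.
  by rewrite size_cat size_rev size_map !size_tuple mul2n addnn.
rewrite -(card_in_image (f := fun p => Tuple (sz p))); last first.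
  move=> [t u] [t' u'] _ _ /(congr1 val)/= /eqP.
  rewrite eqseq_cat ?size_tuple// => /andP[/eqP tt' /eqP/(can_inj revK)].
  by move=> /(inj_map (can_inj rev_stepK)) uu'; congr (_, _); exact: val_inj.
apply: subset_leq_card; apply/fintype.subsetP => _ /fintype.imageP[[t u] /and3P[/= ct cu /eqP tu] ->].
rewrite inE /= word_cat word_rev.
by rewrite (code_inj Jr _ _ tu) ?mulgV//; exact: localized_word.
Qed.

(** * Lower bound on the return probability *)

(** At scale [r = 2^k], all marks up to [2r] are among the first [J], with [2^J]
    of order [k^2 r].  The last gap before [mark J.+1] suffices for that as soon
    as [2^J / (J+1)^2 >= 2r], which holds for [J = k + 1 + 2 (L + 4)], with [L]
    the integer part of [log_2 k], because [J + 1 <= 16 * 2^L]. *)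
Lemma marks_sparse (k : nat) : (0 < k)%N ->
  exists2 J, (2 ^ k + 2 ^ k < mark J.+1)%N & (2 ^ J <= 512 * k ^ 2 * 2 ^ k)%N.
Proof.
move=> k0; pose L := trunc_log 2 k.
have Lk : (2 ^ L <= k)%N by rewrite trunc_logP.
have kL : (k < 2 * 2 ^ L)%N by rewrite -expnS trunc_log_ltn.
have LL : (L < 2 ^ L)%N by exact: ltn_expl.
have expE : (2 ^ (k.+1 + 2 * (L + 4)) = 2 ^ k * 2 * (2 ^ L * 16) ^ 2)%N.
  by rewrite expnD expnSr (mulnC 2 (L + 4)) expnM (expnD _ L 4).
exists (k.+1 + 2 * (L + 4))%N.
  rewrite markS (leq_trans _ (leq_addl _ _))// /gap ltnS leq_divRL ?expn_gt0//.
  rewrite expE addnn -muln2 leq_mul2l; apply/orP; right.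
  by rewrite leq_sqr; lia.
rewrite expE expnMn; have : ((2 ^ L) ^ 2 <= k ^ 2)%N by rewrite leq_sqr.
nia.
Qed.

Section ReturnProbability.
Variable R : realType.

Definition walk_gen (i : step) : generated (range gen) :=
  Generated (mem_generated (ex_intro2 _ _ i I erefl : range gen (gen i))).

Definition walk_law : generated (range gen) -> R := uniform_steps R walk_gen.

Lemma val_walk_word (s : seq step) : val (\prod_(i <- s) walk_gen i)%g = word s.
Proof. exact: gmulf_prod. Qed.

Lemma return_prob_walk n : return_prob walk_law (2 * n) =
  #|[pred t : (2 * n).-tuple step | word t == 1%g]|%:R / 32 ^+ (2 * n).
Proof.
rewrite return_prob_uniform_steps card_step; congr (_%:R / _).
by apply: eq_card => t; rewrite !inE -val_walk_word -(inj_eq val_inj).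
Qed.

Lemma return_prob_walk_le1 n : return_prob walk_law (2 * n) <= 1.
Proof.
rewrite return_prob_walk ler_pdivrMr ?exprn_gt0// mul1r -natrX ler_nat.
by rewrite (leq_trans (max_card _))// card_tuple card_step.
Qed.

Lemma dir_fair (F : int -> R) :
  \sum_i F (dir i) = #|{: step}|%:R * ((F 1 + F (-1)) / 2).
Proof. by rewrite card_step sum_step /= !big_bool /=; lra. Qed.

Lemma return_prob_walk_ge (r J n : nat) : (3 <= r)%N -> (r + r < mark J.+1)%N ->
  (1 - 5 / r%:R ^+ 2) ^+ (2 * n) / #|{: code_type r J}|%:R
    <= return_prob walk_law (2 * n).
Proof.
move=> r3 Jr; have := card_loops n Jr.
set Z := #|[pred t : n.-tuple step | _]|.
set loops := #|[pred t : (2 * n).-tuple step | _]| => le_loops.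
rewrite return_prob_walk -/loops.
have C0 : 0 < #|{: code_type r J}|%:R :> R.
  by rewrite ltr0n card_code_type !muln_gt0 !expn_gt0.
rewrite ler_pdivlMr ?exprn_gt0// mulrAC ler_pdivrMr//.
have Z_ge : (32 * (1 - 5 / r%:R ^+ 2)) ^+ n <= Z%:R :> R.
  have := num_confined0_ge dir_fair n r3; rewrite card_step => /le_trans; apply.
  by rewrite /num_confined -natr_sum /Z -sum1_card [X in (_ <= X%:R)]big_mkcond.
apply: le_trans (_ : Z%:R ^+ 2 <= _); last first.
  by rewrite -natrX -natrM ler_nat mulnC.
have rho0 := rate_ge0 R r3.
by rewrite -exprMn mulrC mulnC exprM ler_sqr ?nnegrE ?exprn_ge0 ?mulr_ge0.
Qed.

Lemma card_code_le (r J : nat) : (0 < r)%N ->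
  #|{: code_type r J}|%:R <= expR (9 * (r * 2 ^ J)%:R) :> R.
Proof.
move=> r0; apply: le_trans (_ : (2 ^ (9 * (r * 2 ^ J)))%:R <= _).
  have J0 : (0 < 2 ^ J)%N by rewrite expn_gt0.
  rewrite ler_nat card_code_type.
  apply: leq_trans (_ : 2 ^ (r + r).+1 * 2 ^ (r + r).+1 * 2 ^ ((r + r).+1 * 2 ^ J) <= _)%N.
    by rewrite !leq_mul2r (ltnW (ltn_expl _ _)) ?orbT.
  by rewrite -!expnD leq_exp2l//; nia.
rewrite natrX -natrM -[X in expR X]mulr1 expRM_natl lerXn2r ?nnegrE ?expR_ge0//.
by apply: le_trans (expR_ge1Dx 1); rewrite -natr1.
Qed.

(** The choice [r = 2^k], of order [n^(1/4)], balances the cost [n / r^2] of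
    confinement with the entropy [r * 2^J] of the reachable set: both are of
    order [4^k], up to the factor [k^2]. *)
Lemma return_prob_walk_exp (k n : nat) : (2 <= k)%N -> (n < 16 ^ k.+1)%N ->
  expR (- (5000 * (k ^ 2 * 4 ^ k)%:R)) <= return_prob walk_law (2 * n).
Proof.
move=> k2 nk; have [|J Jr Jk] := @marks_sparse k; first exact: leq_trans k2.
have r4 : (4 <= 2 ^ k)%N by rewrite -[4%N]/(2 ^ 2)%N leq_exp2l.
apply: le_trans (return_prob_walk_ge n (ltnW r4) Jr).
set r : nat := (2 ^ k)%N in Jr Jk r4 *.
have r0 : (0 < r)%N by apply: leq_trans r4.
have x0 : 0 < (r%:R : R) ^+ 2 by rewrite exprn_gt0// ltr0n.
have rate_ge : expR (- (10 / r%:R ^+ 2)) <= 1 - 5 / r%:R ^+ 2 :> R.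
  (* [1 - x >= exp (- 2 x)] for [x <= 1/2], from [exp (2 x) >= 1 + 2 x]. *)
  set x : R := 5 / r%:R ^+ 2.
  have x2 : x <= 2^-1.
    rewrite ler_pdivrMr// -natrX; apply: le_trans (_ : 2^-1 * 16%:R <= _); first lra.
    by rewrite ler_wpM2l ?invr_ge0// ler_nat; apply: leq_trans (leq_mul r4 r4).
  have xp : 0 <= x by rewrite divr_ge0// ltW.
  have -> : 10 / r%:R ^+ 2 = 2 * x by rewrite /x; ring.
  rewrite expRN -div1r ler_pdivrMr ?expR_gt0//.
  apply: le_trans (_ : (1 - x) * (1 + 2 * x) <= _); first nra.
  by rewrite ler_wpM2l ?expR_ge1Dx//; lra.
rewrite ler_pdivlMr; last by rewrite ltr0n card_code_type !muln_gt0 !expn_gt0.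
apply: le_trans (_ : expR (- (10 / r%:R ^+ 2)) ^+ (2 * n) <= _); last first.
  by rewrite lerXn2r ?nnegrE ?expR_ge0// (le_trans _ rate_ge)// expR_ge0.
apply: le_trans (ler_wpM2l (expR_ge0 _) (card_code_le J r0)) _.
rewrite -expRM_natl -expRD ler_expR mulrN.
have r24 : (r ^ 2 = 4 ^ k)%N by rewrite /r -expnM mulnC expnM.
(* [n < 16 * r^4] bounds the cost of confinement. *)
have n_le : (2 * n)%:R * (10 / r%:R ^+ 2) <= 320 * (4 ^ k)%:R :> R.
  rewrite mulrA ler_pdivrMr// -!natrX r24 -!natrM ler_nat.
  have : (16 ^ k.+1 = 16 * (4 ^ k * 4 ^ k))%N by rewrite expnS -expnMn.
  by move: nk => + E; rewrite E; lia.
have code_le : 9 * (r * 2 ^ J)%:R <= 4608 * (k ^ 2 * 4 ^ k)%:R :> R.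
  rewrite -!natrM ler_nat -r24; nia.
have k2_le : (4 ^ k)%:R <= (k ^ 2 * 4 ^ k)%:R :> R.
  by rewrite ler_nat leq_pmull// expn_gt0 (leq_trans _ k2).
have w0 : 0 <= (k ^ 2 * 4 ^ k)%:R :> R by rewrite ler0n.
move: n_le code_le k2_le w0; move: (_ * (10 / _)) (9 * _) (k ^ 2 * 4 ^ k)%:R (4 ^ k)%:R => u v w z; lra.
Qed.

End ReturnProbability.

(** * The exponent *)

Lemma limn_esup_le (R : realType) (u : nat -> \bar R) (l : \bar R) (N : nat) :
  (forall n, (N <= n)%N -> (u n <= l)%E) -> (limn_esup u <= l)%E.
Proof.
move=> ul; rewrite limn_esup_lim; apply: lime_le; first exact: is_cvg_esups.
exists N => // m /= Nm; apply: ge_ereal_sup => _ [n /= mn <-].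
exact/ul/leq_trans/mn.
Qed.

(** For [k] the integer part of [log_16 n], the logarithm of [C k^2 4^k] is
    [k ln 4 + O(ln k)] while [ln n >= k ln 16]; the crude bound
    [ln k <= 2 sqrt k] makes the error an explicit multiple of [1 / sqrt k]. *)
Lemma upper_exponent_le_half (R : realType) (C : R) (p : nat -> R) :
  1 <= C ->
  (forall n, p n <= 1) ->
  (forall k n, (2 <= k)%N -> (16 ^ k <= n)%N -> (n < 16 ^ k.+1)%N ->
     expR (- (C * (k ^ 2 * 4 ^ k)%:R)) <= p n) ->
  (limn_esup (fun n => (ln `|ln (p n)| / ln n%:R)%:E) <= (2^-1)%:E)%E.
Proof.
move=> C1 p1 pge; apply/lee_addgt0Pr => e e0; rewrite -EFinD.
pose c : R := (ln C + 4) / (4 * ln 2).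
have ln2 : 0 < ln 2 :> R by rewrite ln_gt0// ltr1n.
have c0 : 0 < c.
  by rewrite divr_gt0 ?mulr_gt0// ltr_wpDl// ln_ge0.
(* [k >= (c / e)^2], so that the error [c / sqrt k] is at most [e]. *)
pose K := (Num.truncn ((c / e) ^+ 2)).+2.
apply: (@limn_esup_le _ _ _ (16 ^ K)) => n Kn; rewrite lee_fin.
have n0 : (0 < n)%N by apply: leq_trans Kn; rewrite expn_gt0.
pose k := trunc_log 16 n.
have kn : (16 ^ k <= n)%N by rewrite trunc_logP.
have nk : (n < 16 ^ k.+1)%N by rewrite trunc_log_ltn.
have Kk : (K <= k)%N by apply: trunc_log_max.
have k2 : (2 <= k)%N by apply: leq_trans Kk.
have k0 : 0 < k%:R :> R by rewrite ltr0n (leq_trans _ k2).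
have lnn : 4 * k%:R * ln 2 <= ln n%:R :> R.
  have -> : 4 * k%:R * ln 2 = ln (16 ^ k)%:R :> R.
    rewrite natrX (_ : 16%:R = 2 ^+ 4); last by rewrite -natrX.
    by rewrite -exprM lnXn// -[RHS]mulr_natl natrM.
  by rewrite ler_ln ?posrE ?ltr0n ?expn_gt0// ler_nat.
have lnn0 : 0 < ln n%:R :> R by apply: lt_le_trans lnn; rewrite !mulr_gt0.
have pn0 : 0 < p n by apply: lt_le_trans (pge _ _ k2 kn nk); exact: expR_gt0.
have C0 : 0 < C := lt_le_trans ltr01 C1.
pose X : R := C * (k ^ 2 * 4 ^ k)%:R.
have absln : `|ln (p n)| <= X.
  rewrite ler0_norm ?ln_le0// lerNl -[leLHS]expRK ler_ln ?posrE ?expR_gt0//.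
  exact: pge.
have X1 : 1 <= X.
  by rewrite mulr_ege1// ler1n muln_gt0 !expn_gt0 (leq_trans _ k2).
have lnX : ln X <= ln C + 4 * Num.sqrt k%:R + 2 * k%:R * ln 2.
  have -> : X = C * (k%:R ^+ 2 * 2 ^+ (2 * k)).
    by rewrite /X natrM natrX -[4%N]/(2 ^ 2)%N -expnM natrX.
  rewrite lnM ?posrE ?mulr_gt0 ?exprn_gt0//.
  rewrite [ln (_ * _)]lnM ?posrE ?exprn_gt0// !lnXn//.
  have : ln k%:R <= 2 * Num.sqrt k%:R :> R.
    have kE : k%:R = Num.sqrt k%:R ^+ 2 :> R by rewrite sqr_sqrtr// ltW.
    rewrite {1}kE lnXn ?sqrtr_gt0// -[leLHS]mulr_natl.
    by rewrite ler_wpM2l// ltW// ln_sublinear// sqrtr_gt0.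
  rewrite -(mulr_natl (ln k%:R)) -(mulr_natl (ln 2)) natrM; lra.
have lnln : ln `|ln (p n)| <= ln X.
  have [->|nz] := eqVneq `|ln (p n)| 0; first by rewrite ln0 ?ln_ge0.
  by rewrite ler_ln// posrE ?(lt_le_trans ltr01 X1)// lt_def nz normr_ge0.
rewrite ler_pdivrMr//.
apply: le_trans lnln _; apply: le_trans lnX _.
apply: le_trans (_ : (2^-1 + e) * (4 * k%:R * ln 2) <= _); last first.
  by rewrite ler_wpM2l// addr_ge0// ltW.
set s := Num.sqrt k%:R; have ss : s ^+ 2 = k%:R by rewrite sqr_sqrtr// ltW.
have s1 : 1 <= s by rewrite -sqrtr1 ler_wsqrtr// ler1n (leq_trans _ k2).
have cs : c <= e * s.
  have ce0 : 0 <= c / e by rewrite divr_ge0// ltW.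
  rewrite mulrC -ler_pdivrMr// -ler_sqr ?nnegrE ?(le_trans ler01 s1)// ss.
  apply: le_trans (ltW (truncnS_gt _)) _.
  by rewrite ler_nat (leq_trans _ Kk).
have cE : ln C + 4 = c * (4 * ln 2) by rewrite /c divfK// gt_eqF// mulr_gt0.
have -> : (2^-1 + e) * (4 * k%:R * ln 2) = e * (4 * k%:R * ln 2) + 2 * k%:R * ln 2.
  by field.
rewrite lerD2r -ss.
have lnC0 : 0 <= ln C by rewrite ln_ge0.
apply: le_trans (_ : (ln C + 4) * s <= _); first by nra.
rewrite cE (_ : e * _ = (e * s) * (4 * ln 2) * s); last by ring.
apply: ler_wpM2r; first exact: le_trans ler01 s1.
by apply: ler_wpM2r => //; rewrite mulr_ge0// ltW.
Qed.

Theorem theorem1p1 (R : realType) :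
  exists (G : groupType) (mu : G -> R),
    [/\ finitely_generated G,
        finsupp_probability mu,
        symmetric_measure mu,
        subgroup_generated (msupport mu) = [set: G]
      & ~ liouville mu /\ (upper_return_exponent mu <= (2^-1)%:E)%E].
Proof.
have supp : msupport (walk_law R) = [set x | range gen (val x)].
  rewrite msupport_uniform_steps; apply/seteqP; split=> [_ [i _ <-]|x [i _ ix]].
    by exists i.
  by exists i => //; apply: val_inj.
exists (generated (range gen)), (walk_law R).
have gens : subgroup_generated (msupport (walk_law R)) = setT.
  by rewrite supp; exact: generated_by_gens.
split=> //.
- exists (msupport (walk_law R)) => //.
  by rewrite msupport_uniform_steps; exact: finite_image.
- by apply: uniform_steps_probability; rewrite card_step.
- apply: (uniform_steps_symmetric _ rev_stepK) => i; apply: val_inj.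
  by rewrite gmulfV; exact: gen_rev.
split.
- move=> /(_ (signed_height R \o val)) liou.
  have [||c fc] := liou.
  + move=> g; rewrite (sum_uniform_steps walk_gen (fun x => (signed_height R \o val) (g * x)%g)).
    rewrite -mulr_suml card_step.
    rewrite (eq_bigr (fun i => signed_height R (val g * gen i)%g)) => [|i _].
      by rewrite signed_height_harmonic mulrAC divff ?mul1r.
    by rewrite -[gen i]/(val (walk_gen i)) -valM.
  + exists 4; split=> [|M M4 x _]; first exact: num_real.
    exact: le_trans (signed_height_bound _ _) (ltW M4).
  have fcE (x : generated (range gen)) : signed_height R (val x) = c.
    by have := congr1 (fun f => f x) fc.
  apply: (@signed_height_nonconstant R).
  rewrite -[gen _]/(val (walk_gen _)) fcE -(fcE 1%g).
  by congr signed_height; exact: val1.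
- apply: (@upper_exponent_le_half R 5000) => [|n|k n k2 _ nk].
  + by rewrite ler1n.
  + exact: return_prob_walk_le1.
  + exact: return_prob_walk_exp.
Qed.
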